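(* Let $k$ be a field, let $J$ be a small category and let $F : J \to k\text{-HopfAlg}$ be a functor. Let $\bigl(\prod_{j \in J} F(j), (p_j)_{j \in J}\bigr)$ and $\bigl(\prod_{u \in \mathrm{Hom}(J)} F(\mathrm{cod}(u)), (p_u)_{u \in \mathrm{Hom}(J)}\bigr)$ be the products in $k\text{-HopfAlg}$ of the families $(F(j))_{j \in J}$ and $(F(\mathrm{cod}(u)))_{u \in \mathrm{Hom}(J)}$, respectively. Let $f, g : \prod_{j \in J} F(j) \to \prod_{u \in \mathrm{Hom}(J)} F(\mathrm{cod}(u))$ be the unique Hopf algebra maps such that $p_u \circ f = p_{\mathrm{cod}(u)}$ and $p_u \circ g = F(u) \circ p_{\mathrm{dom}(u)}$ for all $u \in \mathrm{Hom}(J)$. Define $$D = \Bigl\{ x \in \prod_{j \in J} F(j) \;\Big|\; x_{(1)} \otimes f(x_{(2)}) \otimes x_{(3)} = x_{(1)} \otimes g(x_{(2)}) \otimes x_{(3)} \Bigr\}$$ and let $e : D \to \prod_{j \in J} F(j)$ be the canonical inclusion. Then the pair $\bigl(D, (\varphi_j = p_j \circ e)_{j \in J}\bigr)$, where $D$ carries the Hopf algebra structure induced from $\prod_{j \in J} F(j)$, is the limit of the functor $F$ in $k\text{-HopfAlg}$.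
   Context: $k\text{-HopfAlg}$ denotes the category of Hopf algebras over the field $k$ (antipode not assumed bijective) with Hopf algebra maps as morphisms; all products $\prod$ in the claim are categorical products in $k\text{-HopfAlg}$ (which exist), not products of vector spaces. Tensor products are over $k$. Sweedler's notation is used: $\Delta(x) = x_{(1)} \otimes x_{(2)}$ and $(\mathrm{Id} \otimes \Delta)\Delta(x) = x_{(1)} \otimes x_{(2)} \otimes x_{(3)}$, summation understood. For a small category $J$, the index $j \in J$ runs over the objects of $J$, $\mathrm{Hom}(J)$ is the set of all morphisms of $J$, and for a morphism $u$, $\mathrm{dom}(u)$ and $\mathrm{cod}(u)$ are its domain and codomain. *)

(* Defs.v *)
Set Warnings "-notation-overridden,-ambiguous-paths,-redundant-canonical-projection".
From HB Require Import structures.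
From mathcomp Require Import all_boot all_order all_algebra.
From mathcomp Require Import boolp.

Set Implicit Arguments.
Unset Strict Implicit.
Unset Printing Implicit Defensive.

Import GRing.Theory.
Local Open Scope ring_scope.
Local Open Scope quotient_scope.

Reserved Notation "U ⊗ V" (at level 40, left associativity).
Reserved Notation "f \⊗ g" (at level 40, left associativity).

(* The tensor product of two (arbitrary dimensional) k-spaces: formal finite
   sums of pairs, modulo the congruence generated by the bilinearity relations.
   Its universal property is [tensor_lift], [tensor_liftE], [tensor_lift_uniq]. *)
Section TensorProduct.
Variables (k : fieldType) (U V : lmodType k).

Inductive tensor_eq : seq (U * V) -> seq (U * V) -> Prop :=
| teq_refl s : tensor_eq s s
| teq_sym s t : tensor_eq s t -> tensor_eq t s
| teq_trans t s r : tensor_eq s t -> tensor_eq t r -> tensor_eq s r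
| teq_cat s s' t t' :
    tensor_eq s s' -> tensor_eq t t' -> tensor_eq (s ++ t) (s' ++ t')
| teq_catC s t : tensor_eq (s ++ t) (t ++ s)
| teq_0l v : tensor_eq [:: (0, v)] [::]
| teq_Dl u u' v : tensor_eq [:: (u + u', v)] [:: (u, v); (u', v)]
| teq_Dr u v v' : tensor_eq [:: (u, v + v')] [:: (u, v); (u, v')]
| teq_Z a u v : tensor_eq [:: (a *: u, v)] [:: (u, a *: v)].

Definition tensor_eqb : rel (seq (U * V)) := fun s t => `[< tensor_eq s t >].

Lemma tensor_eqb_refl : reflexive tensor_eqb.
Proof. by move=> s; apply/asboolP/teq_refl. Qed.
Lemma tensor_eqb_sym : symmetric tensor_eqb.
Proof. by move=> s t; apply/asboolP/asboolP; apply: teq_sym. Qed.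
Lemma tensor_eqb_trans : transitive tensor_eqb.
Proof.
by move=> t s r /asboolP st /asboolP tr; apply/asboolP/(teq_trans st tr).
Qed.

Canonical tensor_equiv :=
  EquivRel tensor_eqb tensor_eqb_refl tensor_eqb_sym tensor_eqb_trans.

Definition tensor := {eq_quot tensor_equiv}.
HB.instance Definition _ := Choice.on tensor.
HB.instance Definition _ := EqQuotient.on tensor.

Definition tensor_class (s : seq (U * V)) : tensor := \pi_tensor s.

Lemma tensor_classP s t : tensor_class s = tensor_class t <-> tensor_eq s t.
Proof.
rewrite /tensor_class; split => [/eqP|st].
  by rewrite piE => /asboolP.
by apply/eqP; rewrite piE; apply/asboolP.
Qed.

Lemma tensor_classK (t : tensor) : tensor_class (repr t) = t.
Proof. exact: reprK. Qed.

Lemma repr_tensor_class s : tensor_eq (repr (tensor_class s)) s.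
Proof. by apply/tensor_classP; rewrite tensor_classK. Qed.

Definition scale_seq (a : k) (s : seq (U * V)) := [seq (a *: p.1, p.2) | p <- s].

Lemma scale_seq_eq a s t : tensor_eq s t -> tensor_eq (scale_seq a s) (scale_seq a t).
Proof.
elim=> {s t} [s|s t _ st|t s r _ st _ tr|s s' t t' _ ss' _ tt'|s t|v|u u' v|u v v'|b u v].
- exact: teq_refl.
- exact: teq_sym.
- exact: teq_trans st tr.
- by rewrite /scale_seq !map_cat; apply: teq_cat.
- by rewrite /scale_seq !map_cat; apply: teq_catC.
- by rewrite /= scaler0; apply: teq_0l.
- by rewrite /= scalerDr; apply: teq_Dl.
- exact: teq_Dr.
- by rewrite /= scalerA mulrC -scalerA; apply: teq_Z.
Qed.

Definition tensor_zero : tensor := tensor_class [::].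
Definition tensor_add (x y : tensor) : tensor := tensor_class (repr x ++ repr y).
Definition tensor_scale (a : k) (x : tensor) : tensor :=
  tensor_class (scale_seq a (repr x)).
Definition tensor_opp (x : tensor) : tensor := tensor_scale (-1) x.

Lemma tensor_ind_class (P : tensor -> Prop) :
  (forall s, P (tensor_class s)) -> forall x, P x.
Proof. by move=> Ps x; rewrite -[x]tensor_classK. Qed.

Lemma tensor_addE s t :
  tensor_add (tensor_class s) (tensor_class t) = tensor_class (s ++ t).
Proof. by apply/tensor_classP/teq_cat; apply: repr_tensor_class. Qed.

Lemma tensor_scaleE a s :
  tensor_scale a (tensor_class s) = tensor_class (scale_seq a s).
Proof. by apply/tensor_classP/scale_seq_eq/repr_tensor_class. Qed.

Lemma tensor_addA : associative tensor_add.
Proof.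
elim/tensor_ind_class => r; elim/tensor_ind_class => s; elim/tensor_ind_class => t.
by rewrite !tensor_addE catA.
Qed.

Lemma tensor_addC : commutative tensor_add.
Proof.
elim/tensor_ind_class => s; elim/tensor_ind_class => t.
by rewrite !tensor_addE; apply/tensor_classP/teq_catC.
Qed.

Lemma tensor_add0 : left_id tensor_zero tensor_add.
Proof. by elim/tensor_ind_class => s; rewrite tensor_addE. Qed.

Lemma tensor_scaleDl x : {morph tensor_scale^~ x : a b / a + b >-> tensor_add a b}.
Proof.
elim/tensor_ind_class: x => + a b; elim=> [|[u v] s IHs].
  by rewrite !tensor_scaleE tensor_addE.
rewrite !tensor_scaleE tensor_addE.
have -> : scale_seq (a + b) ((u, v) :: s) =
          [:: (a *: u + b *: u, v)] ++ scale_seq (a + b) s.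
  by rewrite /= scalerDl.
have -> : scale_seq a ((u, v) :: s) ++ scale_seq b ((u, v) :: s) =
          ([:: (a *: u, v)] ++ scale_seq a s) ++ ([:: (b *: u, v)] ++ scale_seq b s).
  by [].
rewrite -!tensor_addE -!tensor_scaleE IHs.
have -> : tensor_class [:: (a *: u + b *: u, v)] =
          tensor_add (tensor_class [:: (a *: u, v)]) (tensor_class [:: (b *: u, v)]).
  by rewrite tensor_addE; apply/tensor_classP/teq_Dl.
rewrite -!tensor_addA; congr tensor_add; rewrite !tensor_addA; congr tensor_add.
exact: tensor_addC.
Qed.

Lemma tensor_scale0 x : tensor_scale 0 x = tensor_zero.
Proof.
elim/tensor_ind_class: x => s; rewrite tensor_scaleE; apply/tensor_classP.
elim: s => [|[u v] s IHs] /=; first exact: teq_refl.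
rewrite scale0r; apply: (@teq_cat [:: _] [::] _ [::]) => //; exact: teq_0l.
Qed.

Lemma tensor_scale1 : left_id 1 tensor_scale.
Proof.
elim/tensor_ind_class => s; rewrite tensor_scaleE; congr tensor_class.
by elim: s => [|[u v] s IHs] //=; rewrite scale1r IHs.
Qed.

Lemma tensor_addN : left_inverse tensor_zero tensor_opp tensor_add.
Proof.
by move=> x; rewrite -{2}[x]tensor_scale1 -tensor_scaleDl addNr tensor_scale0.
Qed.

HB.instance Definition _ :=
  GRing.isZmodule.Build tensor tensor_addA tensor_addC tensor_add0 tensor_addN.

Lemma tensor_scaleA a b x : tensor_scale a (tensor_scale b x) = tensor_scale (a * b) x.
Proof.
elim/tensor_ind_class: x => s; rewrite !tensor_scaleE; congr tensor_class.
by rewrite /scale_seq -map_comp; apply: eq_map => p /=; rewrite scalerA.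
Qed.

Lemma tensor_scaleDr : right_distributive tensor_scale +%R.
Proof.
move=> a; elim/tensor_ind_class => s; elim/tensor_ind_class => t.
rewrite /GRing.add /= !(tensor_addE, tensor_scaleE); congr tensor_class.
by rewrite /scale_seq map_cat.
Qed.

HB.instance Definition _ := GRing.Zmodule_isLmodule.Build k tensor
  tensor_scaleA tensor_scale1 tensor_scaleDr tensor_scaleDl.

Lemma tensor_class_cat s t :
  tensor_class s + tensor_class t = tensor_class (s ++ t).
Proof. exact: tensor_addE. Qed.

Lemma tensor_class_scale a s : a *: tensor_class s = tensor_class (scale_seq a s).
Proof. exact: tensor_scaleE. Qed.

Definition tpure (u : U) (v : V) : tensor := tensor_class [:: (u, v)].

Lemma tpure_bilinear : bilinear_for *:%R *:%R tpure.
Proof.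
split=> [v a u u'|u a v v'] /=.
  rewrite /tpure tensor_class_scale tensor_class_cat.
  exact/tensor_classP/teq_Dl.
transitivity (tensor_class [:: (u, a *: v); (u, v')]).
  exact/tensor_classP/teq_Dr.
rewrite /tpure tensor_class_scale tensor_class_cat.
apply/tensor_classP/(@teq_cat [:: _] [:: _] [:: _] [:: _]); last exact: teq_refl.
exact/teq_sym/teq_Z.
Qed.

HB.instance Definition _ :=
  bilinear_isBilinear.Build k U V tensor *:%R *:%R tpure tpure_bilinear.

Lemma tensor_class_sum s : tensor_class s = \sum_(p <- s) tpure p.1 p.2.
Proof.
elim: s => [|[u v] s IHs]; first by rewrite big_nil.
by rewrite big_cons /= -IHs tensor_class_cat.
Qed.

Lemma tensor_ind (P : tensor -> Prop) :
    P 0 -> (forall u v x, P x -> P (tpure u v + x)) ->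
  forall x, P x.
Proof.
move=> P0 PD; elim/tensor_ind_class; elim=> [|[u v] s IHs] //.
by rewrite tensor_class_sum big_cons -tensor_class_sum; apply: PD.
Qed.

Section Lift.
Variables (W : lmodType k) (b : {bilinear U -> V -> W}).

Definition tensor_lift (x : tensor) : W := \sum_(p <- repr x) b p.1 p.2.

Lemma tensor_lift_class s : tensor_lift (tensor_class s) = \sum_(p <- s) b p.1 p.2.
Proof.
rewrite /tensor_lift; move: (repr (tensor_class s)) (repr_tensor_class s) => r.
elim=> {r s}
  [s|s t _ ->|t s r _ -> _ ->|s s' t t' _ ss' _ tt'|s t|v|u u' v|u v v'|a u v] //.
- by rewrite !big_cat /= ss' tt'.
- by rewrite !big_cat /= addrC.
- by rewrite big_seq1 big_nil linear0l.
- by rewrite !big_cons !big_nil /= !addr0 linearDl.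
- by rewrite !big_cons !big_nil /= !addr0 linearDr.
- by rewrite !big_seq1 /= linearZl_LR linearZr_LR.
Qed.

Lemma tensor_lift_linear : linear tensor_lift.
Proof.
move=> a; elim/tensor_ind_class => s; elim/tensor_ind_class => t.
rewrite tensor_class_scale tensor_class_cat !tensor_lift_class.
rewrite big_cat big_map scaler_sumr; congr (_ + _).
by apply: eq_bigr => p _; rewrite linearZl_LR.
Qed.

HB.instance Definition _ :=
  GRing.isLinear.Build k tensor W *:%R tensor_lift tensor_lift_linear.

Lemma tensor_liftE u v : tensor_lift (tpure u v) = b u v.
Proof. by rewrite tensor_lift_class big_seq1. Qed.

Lemma tensor_lift_uniq (h : {linear tensor -> W}) :
  (forall u v, h (tpure u v) = b u v) -> h =1 tensor_lift.
Proof.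
move=> hE; elim/tensor_ind => [|u v x IHx]; first by rewrite !linear0.
by rewrite !linearD /= IHx hE tensor_liftE.
Qed.

End Lift.

Lemma tensor_ext (W : lmodType k) (h h' : {linear tensor -> W}) :
  (forall u v, h (tpure u v) = h' (tpure u v)) -> h =1 h'.
Proof.
move=> hE; elim/tensor_ind => [|u v x IHx]; first by rewrite !linear0.
by rewrite !linearD /= IHx hE.
Qed.

End TensorProduct.

(* [U ⊗ V] denotes the bundled lmodType on [tensor U V], so that nested tensor
   products need no reverse coercion. *)
Notation "U ⊗ V" := (Defs_tensor__canonical__GRing_Lmodule U%type V%type) : type_scope.
Notation "u ⊗ v" := (tpure u v) : ring_scope.

Section TensorMap.
Variables (k : fieldType) (U U' V V' : lmodType k).
Variables (f : {linear U -> U'}) (g : {linear V -> V'}).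

Definition tpure_map (u : U) (v : V) : U' ⊗ V' := f u ⊗ g v.

Lemma tpure_map_bilinear : bilinear_for *:%R *:%R tpure_map.
Proof.
split=> [v a u u'|u a v v']; rewrite /tpure_map /= linearP.
  by rewrite linearPl.
by rewrite linearPr.
Qed.

HB.instance Definition _ :=
  bilinear_isBilinear.Build k U V (U' ⊗ V')%type *:%R *:%R tpure_map tpure_map_bilinear.

(* f ⊗ g : U ⊗ V -> U' ⊗ V' *)
Definition tensor_map : U ⊗ V -> U' ⊗ V' := tensor_lift tpure_map.
HB.instance Definition _ := GRing.Linear.on tensor_map.

Lemma tensor_mapE u v : tensor_map (u ⊗ v) = f u ⊗ g v.
Proof. exact: tensor_liftE. Qed.

End TensorMap.

Notation "f \⊗ g" := (tensor_map f g) : function_scope.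

Section TensorAssoc.
Variables (k : fieldType) (U V W : lmodType k).

Section Fixed.
Variable w : W.
Definition tpure_assoc_r (u : U) (v : V) : U ⊗ (V ⊗ W) := u ⊗ (v ⊗ w).

Lemma tpure_assoc_r_bilinear : bilinear_for *:%R *:%R tpure_assoc_r.
Proof.
split=> [v a u u'|u a v v']; rewrite /tpure_assoc_r /=; first by rewrite linearPl.
by rewrite linearPl linearPr.
Qed.

HB.instance Definition _ := bilinear_isBilinear.Build k U V (U ⊗ (V ⊗ W))%type *:%R *:%R
  tpure_assoc_r tpure_assoc_r_bilinear.
End Fixed.

Definition tpure_assoc (x : U ⊗ V) (w : W) : U ⊗ (V ⊗ W) :=
  tensor_lift (tpure_assoc_r w) x.

Lemma tpure_assoc_bilinear : bilinear_for *:%R *:%R tpure_assoc.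
Proof.
split=> [w a x x'|x a w w']; rewrite /tpure_assoc /=; first by rewrite linearP.
elim/tensor_ind: x => [|u v x IHx]; first by rewrite !linear0 ?scaler0 addr0.
rewrite !linearD /= IHx !tensor_liftE addrACA; congr (_ + _).
by rewrite /= /tpure_assoc_r linearPr linearPr.
Qed.

HB.instance Definition _ := bilinear_isBilinear.Build k (U ⊗ V)%type W
  (U ⊗ (V ⊗ W))%type *:%R *:%R tpure_assoc tpure_assoc_bilinear.

(* (U ⊗ V) ⊗ W -> U ⊗ (V ⊗ W) *)
Definition tensor_assoc : (U ⊗ V) ⊗ W -> U ⊗ (V ⊗ W) := tensor_lift tpure_assoc.
HB.instance Definition _ := GRing.Linear.on tensor_assoc.

Lemma tensor_assocE u v w : tensor_assoc ((u ⊗ v) ⊗ w) = u ⊗ (v ⊗ w).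
Proof. by rewrite /tensor_assoc tensor_liftE /= /tpure_assoc tensor_liftE. Qed.

End TensorAssoc.

Section TensorUnit.
Variables (k : fieldType) (U : lmodType k).

Definition scale_l (a : k^o) (u : U) : U := a *: u.
Definition scale_r (u : U) (a : k^o) : U := a *: u.

Lemma scale_l_bilinear : bilinear_for *:%R *:%R scale_l.
Proof.
split=> [u a b c|b a u v]; rewrite /scale_l /=; first by rewrite scalerDl scalerA.
by rewrite scalerDr !scalerA mulrC.
Qed.
Lemma scale_r_bilinear : bilinear_for *:%R *:%R scale_r.
Proof. by have [h h'] := scale_l_bilinear; split=> [b a u v|u a b c]; [apply: h'|apply: h]. Qed.

HB.instance Definition _ :=
  bilinear_isBilinear.Build k k^o U U *:%R *:%R scale_l scale_l_bilinear.
HB.instance Definition _ :=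
  bilinear_isBilinear.Build k U k^o U *:%R *:%R scale_r scale_r_bilinear.

(* The canonical isomorphisms k ⊗ U -> U and U ⊗ k -> U *)
Definition tensor_unitl : k^o ⊗ U -> U := tensor_lift scale_l.
Definition tensor_unitr : U ⊗ k^o -> U := tensor_lift scale_r.
HB.instance Definition _ := GRing.Linear.on tensor_unitl.
HB.instance Definition _ := GRing.Linear.on tensor_unitr.

Lemma tensor_unitlE a u : tensor_unitl ((a : k^o) ⊗ u) = a *: u.
Proof. exact: tensor_liftE. Qed.
Lemma tensor_unitrE u a : tensor_unitr (u ⊗ (a : k^o)) = a *: u.
Proof. exact: tensor_liftE. Qed.

End TensorUnit.

Section AlgebraMul.
Variables (k : fieldType) (A : algType k).

Definition alg_mul (x y : A) : A := x * y.
Lemma alg_mul_bilinear : bilinear_for *:%R *:%R alg_mul.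
Proof.
split=> [y a x x'|x a y y']; rewrite /alg_mul /=; first by rewrite mulrDl scalerAl.
by rewrite mulrDr scalerAr.
Qed.
HB.instance Definition _ :=
  bilinear_isBilinear.Build k A A A *:%R *:%R alg_mul alg_mul_bilinear.

(* The multiplication of A as a linear map A ⊗ A -> A *)
Definition tensor_mult : A ⊗ A -> A := tensor_lift alg_mul.
HB.instance Definition _ := GRing.Linear.on tensor_mult.

Lemma tensor_multE x y : tensor_mult (x ⊗ y) = x * y.
Proof. exact: tensor_liftE. Qed.

End AlgebraMul.

(* The tensor product algebra A ⊗ B: (a ⊗ b) (c ⊗ d) = (a * c) ⊗ (b * d). *)
Section TensorAlgebra.
Variables (k : fieldType) (A B : algType k).

Section Fixed.
Variables (a : A) (b : B).
Definition tmul_pure (c : A) (d : B) : A ⊗ B := (a * c) ⊗ (b * d).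

Lemma tmul_pure_bilinear : bilinear_for *:%R *:%R tmul_pure.
Proof.
split=> [d r c c'|c r d d']; rewrite /tmul_pure /= mulrDr -scalerAr.
  by rewrite linearPl.
by rewrite linearPr.
Qed.
HB.instance Definition _ := bilinear_isBilinear.Build k A B (A ⊗ B)%type *:%R *:%R
  tmul_pure tmul_pure_bilinear.
End Fixed.

Section FixedR.
Variable y : A ⊗ B.
Definition tmul_r (a : A) (b : B) : A ⊗ B := tensor_lift (tmul_pure a b) y.

Lemma tmul_r_bilinear : bilinear_for *:%R *:%R tmul_r.
Proof.
rewrite /tmul_r; elim/tensor_ind: y => [|c d x [IHl IHr]].
  by split=> [b r a a'|a r b b'] /=; rewrite !linear0 ?scaler0 addr0.
split=> [b r a a'|a r b b']; rewrite /= !linearD /= !tensor_liftE.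
  rewrite [X in _ + X]IHl addrACA; congr (_ + _).
  by rewrite /= /tmul_pure mulrDl -scalerAl linearPl.
rewrite [X in _ + X]IHr addrACA; congr (_ + _).
by rewrite /= /tmul_pure mulrDl -scalerAl linearPr.
Qed.
HB.instance Definition _ := bilinear_isBilinear.Build k A B (A ⊗ B)%type *:%R *:%R
  tmul_r tmul_r_bilinear.
End FixedR.

Definition tmul (x y : A ⊗ B) : A ⊗ B := tensor_lift (tmul_r y) x.

Lemma tmulE a b c d : tmul (a ⊗ b) (c ⊗ d) = (a * c) ⊗ (b * d).
Proof. by rewrite /tmul tensor_liftE /= /tmul_r tensor_liftE. Qed.

Lemma tmulDl : left_distributive tmul +%R.
Proof. by move=> x y z; rewrite /tmul linearD. Qed.

Lemma tmul0 : left_zero 0 tmul.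
Proof. by move=> x; rewrite /tmul linear0. Qed.

Lemma tmulDr : right_distributive tmul +%R.
Proof.
move=> x y z; elim/tensor_ind: x => [|a b x IHx]; first by rewrite !tmul0 addr0.
rewrite !tmulDl IHx addrACA; congr (_ + _).
by rewrite /tmul !tensor_liftE /= /tmul_r linearD.
Qed.

Lemma tmulr0 : right_zero 0 tmul.
Proof. by move=> x; apply: (@addrI _ (tmul x 0)); rewrite -tmulDr !addr0. Qed.

Lemma tmulA : associative tmul.
Proof.
move=> x y z; elim/tensor_ind: x => [|a b x IHx]; first by rewrite !tmul0.
rewrite !tmulDl IHx; congr (_ + _); clear.
elim/tensor_ind: y => [|c d y IHy]; first by rewrite !(tmul0, tmulr0).
rewrite !(tmulDl, tmulDr) IHy; congr (_ + _); clear.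
elim/tensor_ind: z => [|e f z IHz]; first by rewrite !tmulr0.
by rewrite !tmulDr IHz !tmulE !mulrA.
Qed.

Lemma tmul1l : left_id (1 ⊗ 1) tmul.
Proof.
elim/tensor_ind => [|a b x IHx]; first by rewrite tmulr0.
by rewrite tmulDr IHx tmulE !mul1r.
Qed.

Lemma tmul1r : right_id (1 ⊗ 1) tmul.
Proof.
elim/tensor_ind => [|a b x IHx]; first by rewrite tmul0.
by rewrite tmulDl IHx tmulE !mulr1.
Qed.

HB.instance Definition _ := GRing.Zmodule_isPzRing.Build (tensor A B)
  tmulA tmul1l tmul1r tmulDl tmulDr.

End TensorAlgebra.

HB.mixin Record Lmodule_isCoalgebra (k : fieldType) C of GRing.Lmodule k C := {
  comul : {linear C -> (C ⊗ C)%type};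
  counit : {linear C -> k^o};
  comulA : forall x : C,
    tensor_assoc ((comul \⊗ idfun) (comul x)) = (idfun \⊗ comul) (comul x);
  counitl : forall x : C, tensor_unitl ((counit \⊗ idfun) (comul x)) = x;
  counitr : forall x : C, tensor_unitr ((idfun \⊗ counit) (comul x)) = x
}.

#[short(type="coalgType")]
HB.structure Definition Coalgebra (k : fieldType) :=
  {C of GRing.Lmodule k C & Lmodule_isCoalgebra k C}.

HB.mixin Record isBialgebra (k : fieldType) B of GRing.Algebra k B & Coalgebra k B := {
  comul_monoid_morphism : monoid_morphism (comul : B -> (B ⊗ B)%type);
  counit_monoid_morphism : monoid_morphism (counit : B -> k)
}.

#[short(type="bialgType")]
HB.structure Definition Bialgebra (k : fieldType) :=
  {B of GRing.Algebra k B & Coalgebra k B & isBialgebra k B}.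

HB.mixin Record hasAntipode (k : fieldType) H of Bialgebra k H := {
  antipode : {linear H -> H};
  antipodel : forall x : H,
    tensor_mult ((antipode \⊗ idfun) (comul x)) = (counit x : k) *: 1;
  antipoder : forall x : H,
    tensor_mult ((idfun \⊗ antipode) (comul x)) = (counit x : k) *: 1
}.

(* The antipode is not required to be bijective. MathComp algebras satisfy
   [1 != 0]; this excludes nothing, as [counit 1 = 1] forces it. *)
#[short(type="hopfAlgType")]
HB.structure Definition HopfAlgebra (k : fieldType) :=
  {H of Bialgebra k H & hasAntipode k H}.

HB.mixin Record isCoalgMorphism (k : fieldType) (C D : coalgType k) (f : C -> D)
    of @GRing.Linear k C D *:%R f := {
  comul_morph : forall x, comul (f x) = (f \⊗ f) (comul x);
  counit_morph : forall x, counit (f x) = counit x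
}.

(* Hopf algebra maps are the bialgebra maps; such maps automatically commute
   with the antipodes. *)
HB.structure Definition HopfMorphism (k : fieldType) (A B : hopfAlgType k) :=
  {f of @GRing.LRMorphism k A B *:%R f & @isCoalgMorphism k A B f}.

Notation "{ 'hopf' A -> B }" := (@HopfMorphism.type _ A%type B%type)
  (at level 0, A at level 98, B at level 99, format "{ 'hopf'  A  ->  B }") : type_scope.

Lemma tensor_map_id (k : fieldType) (U V : lmodType k) :
  (@idfun U \⊗ @idfun V) =1 id.
Proof.
exact: (@tensor_ext _ _ _ _ (@idfun U \⊗ @idfun V)%FUN idfun (tensor_mapE _ _)).
Qed.

Lemma tensor_map_comp (k : fieldType) (U U' U'' V V' V'' : lmodType k)
    (f' : {linear U' -> U''}) (f : {linear U -> U'})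
    (g' : {linear V' -> V''}) (g : {linear V -> V'}) :
  (f' \o f) \⊗ (g' \o g) =1 (f' \⊗ g') \o (f \⊗ g).
Proof.
apply: (@tensor_ext _ _ _ _ ((f' \o f) \⊗ (g' \o g))%FUN ((f' \⊗ g') \o (f \⊗ g))%FUN).
by move=> u v /=; rewrite !tensor_mapE.
Qed.

Section HopfMorphismOps.
Variables (k : fieldType) (A B C : hopfAlgType k).
Variables (g : {hopf B -> C}) (f : {hopf A -> B}).

Fact idfun_comul (x : A) : comul (idfun x) = (idfun \⊗ idfun) (comul x).
Proof. by rewrite tensor_map_id. Qed.
HB.instance Definition _ :=
  isCoalgMorphism.Build k A A idfun idfun_comul (fun=> erefl).

Fact comp_comul x : comul ((g \o f) x) = ((g \o f) \⊗ (g \o f)) (comul x).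
Proof. by rewrite tensor_map_comp /= !comul_morph. Qed.
Fact comp_counit x : counit ((g \o f) x) = counit x.
Proof. by rewrite /= !counit_morph. Qed.
HB.instance Definition _ :=
  isCoalgMorphism.Build k A C (g \o f) comp_comul comp_counit.

End HopfMorphismOps.

Lemma hopf_morphism_ext (k : fieldType) (A B : hopfAlgType k) (f g : {hopf A -> B}) :
  f =1 g -> f = g.
Proof.
case: f g => [f [[[f1 fM]] [[f0 fD]] [fZ] [fc fe]]].
case=> [g [[[g1 gM]] [[g0 gD]] [gZ] [gc ge]]] /= /funext efg.
case: _ / efg in g1 gM g0 gD gZ gc ge *.
have e1 : f1 = g1 by exact: Prop_irrelevance.
have eM : fM = gM by exact: Prop_irrelevance.
have e0 : f0 = g0 by exact: Prop_irrelevance.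
have eD : fD = gD by exact: Prop_irrelevance.
have eZ : fZ = gZ by exact: Prop_irrelevance.
case: _ / e1; case: _ / eM; case: _ / e0 in gc ge *; case: _ / eD in gc ge *.
case: _ / eZ in gc ge *.
have ec : fc = gc by exact: Prop_irrelevance.
have ee : fe = ge by exact: Prop_irrelevance.
by case: _ / ec; case: _ / ee.
Qed.

(* A Hopf algebra structure on the subset S of H, induced from that of H: the
   inclusion [val] is a morphism of algebras and of coalgebras. *)
HB.mixin Record isSubCoalgebra (k : fieldType) (C : coalgType k) (S : pred C) W
    of @GRing.SubLmodule k C S W & Coalgebra k W := {
  val_comul : forall x : W, comul (val x : C) = (val \⊗ val) (comul x);
  val_counit : forall x : W, counit (val x : C) = counit x
}.

#[short(type="subHopfAlgType")]
HB.structure Definition SubHopfAlgebra (k : fieldType) (H : hopfAlgType k) (S : pred H) :=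
  {W of @GRing.SubAlgebra k H S W & HopfAlgebra k W & @isSubCoalgebra k H S W}.

Section SubHopfVal.
Variables (k : fieldType) (H : hopfAlgType k) (S : pred H) (W : subHopfAlgType S).
HB.instance Definition _ :=
  isCoalgMorphism.Build k W H (val : W -> H) val_comul val_counit.
End SubHopfVal.

(* No size restriction is built in: a small category is one whose objects live in
   a universe of the size of the carriers of Hopf algebras. *)
Record category := Category {
  Ob :> Type;
  Mor : Ob -> Ob -> Type;
  cid : forall a, Mor a a;
  ccomp : forall a b c, Mor b c -> Mor a b -> Mor a c;
  ccompA : forall a b c d (h : Mor c d) (g : Mor b c) (f : Mor a b),
    ccomp h (ccomp g f) = ccomp (ccomp h g) f;
  ccomp1f : forall a b (f : Mor a b), ccomp (cid b) f = f;
  ccompf1 : forall a b (f : Mor a b), ccomp f (cid a) = f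
}.

(* The elements of Hom(C), the set of all morphisms of C *)
Record arrow (C : category) := Arrow {
  adom : C;
  acod : C;
  arr :> Mor adom acod
}.

Record functor (C D : category) := Functor {
  fob :> C -> D;
  fmap : forall a b, Mor a b -> Mor (fob a) (fob b);
  fmap_id : forall a, fmap (cid a) = cid (fob a);
  fmap_comp : forall a b c (g : Mor b c) (f : Mor a b),
    fmap (ccomp g f) = ccomp (fmap g) (fmap f)
}.

Definition is_product (C : category) (I : Type) (X : I -> C)
    (P : C) (p : forall i, Mor P (X i)) :=
  forall (Y : C) (q : forall i, Mor Y (X i)),
    exists! h : Mor Y P, forall i, ccomp (p i) h = q i.

Definition is_cone (J C : category) (F : functor J C)
    (L : C) (phi : forall j, Mor L (F j)) :=
  forall (i j : J) (u : Mor i j), ccomp (fmap F u) (phi i) = phi j.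

Definition is_limit (J C : category) (F : functor J C)
    (L : C) (phi : forall j, Mor L (F j)) :=
  is_cone phi /\
  forall (Y : C) (psi : forall j, Mor Y (F j)), is_cone psi ->
    exists! h : Mor Y L, forall j, ccomp (phi j) h = psi j.

Section HopfAlgCategory.
Variable k : fieldType.

Definition hopf_id (A : hopfAlgType k) : {hopf A -> A} := idfun.
Definition hopf_comp (A B C : hopfAlgType k) (g : {hopf B -> C}) (f : {hopf A -> B}) :
  {hopf A -> C} := g \o f.

Fact hopf_compA (A B C D : hopfAlgType k)
    (h : {hopf C -> D}) (g : {hopf B -> C}) (f : {hopf A -> B}) :
  hopf_comp h (hopf_comp g f) = hopf_comp (hopf_comp h g) f.
Proof. exact: hopf_morphism_ext. Qed.
Fact hopf_comp1f (A B : hopfAlgType k) (f : {hopf A -> B}) :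
  hopf_comp (hopf_id B) f = f.
Proof. exact: hopf_morphism_ext. Qed.
Fact hopf_compf1 (A B : hopfAlgType k) (f : {hopf A -> B}) :
  hopf_comp f (hopf_id A) = f.
Proof. exact: hopf_morphism_ext. Qed.

Definition HopfAlg : category :=
  Category hopf_compA hopf_comp1f hopf_compf1.

End HopfAlgCategory.

(* The set D = {x | x_(1) ⊗ f(x_(2)) ⊗ x_(3) = x_(1) ⊗ g(x_(2)) ⊗ x_(3)}, where
   x_(1) ⊗ x_(2) ⊗ x_(3) is (Id ⊗ Δ)(Δ(x)) in A ⊗ (A ⊗ A). *)
Definition hopf_eq_set (k : fieldType) (A B : hopfAlgType k) (f g : {hopf A -> B}) :
    pred A :=
  fun x => `[< (idfun \⊗ (f \⊗ idfun)) ((idfun \⊗ comul) (comul x)) =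
               (idfun \⊗ (g \⊗ idfun)) ((idfun \⊗ comul) (comul x)) >].

Definition hopf_incl (k : fieldType) (H : hopfAlgType k) (S : pred H)
  (D : subHopfAlgType S) : {hopf D -> H} := (val : D -> H).

(* Main.v *)
Set Warnings "-notation-overridden,-ambiguous-paths,-redundant-canonical-projection".
Require Import Defs.
From HB Require Import structures.
From mathcomp Require Import all_boot all_order all_algebra.
From mathcomp Require Import boolp classical_sets.

Set Implicit Arguments.
Unset Strict Implicit.
Unset Printing Implicit Defensive.

Import GRing.Theory.
Local Open Scope ring_scope.

(** The set D of the statement is the largest subcoalgebra of P on which the Hopf
    algebra maps [f] and [g] agree, and it is in fact a Hopf subalgebra, the
    equalizer of [f] and [g]. The limit is then the equalizer of the two maps
    between products, as in any category: applying the counit to the outer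
    factors of the defining equation gives [f = g] on D ([hopf_eq_set_eq]), so the
    restricted projections form a cone; a cone induces a map [h] into P with
    [f h = g h], by uniqueness of maps into Q, and such a map takes its values in
    D since it is comultiplicative ([hopf_eq_factor_in]).

    Write [sandwich f] for the map x ↦ x_(1) ⊗ f(x_(2)) ⊗ x_(3). Being a composite of
    algebra maps, it is one, so D, the equalizer of [sandwich f] and [sandwich g], is
    a subalgebra.

    D is a subcoalgebra. By coassociativity, applying [sandwich f] to one factor of
    Δ(x) amounts to comultiplying an outer factor of [sandwich f x]
    ([sandwich_comull], [sandwich_comulr]). Hence for x in D the maps [sandwich f] and
    [sandwich g] cannot be told apart on either factor of Δ(x). When Δ(x) is written
    as a sum of pure tensors of minimal length, the components on each side are
    linearly independent ([tensor_decomp]), so each component lies in D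
    ([tensor_sum_coefl], [tensor_sum_coefr], [comul_sandwich_eq]). The spaces being of
    arbitrary dimension, the dual functionals used here come from Zorn's lemma
    ([separating_functional]).

    D is stable under the antipode S. On the coalgebra D the algebra maps
    [sandwich f] and [sandwich g] coincide, and their composites with S are convolution
    inverses of them, hence coincide as well ([algebra_maps_eq_antipode]). *)

(** * Linear functionals separating a vector from a subspace *)

Section Separation.
Variables (k : fieldType) (V : lmodType k).
Implicit Type M : V -> Prop.

Definition subspace M := M 0 /\ forall (a : k) x y, M x -> M y -> M (a *: x + y).

(** A subspace that is maximal among those containing [M] and avoiding [v] is a
    complement of the line through [v]: for [x] outside it, enlarging it by [x]
    must capture [v], so that [x] is congruent to a multiple of [v]. *)
Lemma maximal_subspace M : subspace M -> forall v, ~ M v ->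
  exists N, [/\ subspace N, forall x, M x -> N x, ~ N v &
    forall x, exists a : k, N (x - a *: v)].
Proof.
move=> [M0 Mlin] v Mv.
(* Zorn's lemma is applied to sets that may be empty, since the union of the
   empty chain must qualify. Stability under translation by [M] makes every
   nonempty such set contain [M]. *)
pose P (A : set V) := [/\ ~ A v,
  forall (a : k) x y, A x -> A y -> A (a *: x + y) &
  forall m x, M m -> A x -> A (m + x)].
have PM : P M.
  by split=> // m x Mm Mx; rewrite -[m]scale1r; apply: Mlin.
have [C CP Ctot|N [[Nv Nlin NM] Nmax]] := @Zorn_bigcup V P.
  split=> [[A CA Av]|a x y [A CA Ax] [B CB By]|m x Mm [A CA Ax]].
  - by have [] := CP _ CA.
  - have [AB|BA] := Ctot _ _ CA CB.
      by exists B => //; have [_ + _] := CP _ CB; apply=> //; apply: AB.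
    by exists A => //; have [_ + _] := CP _ CA; apply=> //; apply: BA.
  - by exists A => //; have [_ _] := CP _ CA; apply.
have maximal (B : set V) : P B -> (forall x, N x -> B x) -> forall x, B x -> N x.
  by move=> PB NB; apply: contrapT => BN; apply: (Nmax B).
have [x0 Nx0] : exists x, N x.
  apply: contrapT => N0; apply: (N0); exists 0.
  by apply: (maximal M) => // x Nx; case: N0; exists x.
have N0 : N 0 by rewrite -(addNr x0) -scaleN1r; apply: Nlin.
exists N; split=> // [x Mx|x].
  by rewrite -[x]addr0; apply: NM.
have [Nx|Nx] := pselect (N x); first by exists 0; rewrite scale0r subr0.
pose B y := exists a : k, N (y - a *: x).
have NB y : N y -> B y by exists 0; rewrite scale0r subr0.
have Bx : B x by exists 1; rewrite scale1r subrr.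
have [b Nb] : B v.
  apply: contrapT => Bv; apply: Nx; apply: (maximal B) => //; split=> //.
    move=> a y z [c Nc] [d Nd]; exists (a * c + d).
    by rewrite scalerDl opprD addrACA -scalerA -scalerBr; apply: Nlin.
  by move=> m y Mm [c Nc]; exists c; rewrite -addrA; apply: NM.
have b0 : b != 0.
  by apply/eqP => b0; apply: Nv; move: Nb; rewrite b0 scale0r subr0.
exists b^-1; have -> : x - b^-1 *: v = - b^-1 *: (v - b *: x) + 0.
  by rewrite addr0 scalerBr scalerA mulNr mulVf // !scaleNr scale1r opprK addrC.
exact: Nlin.
Qed.

(** The functional sends [x] to its coordinate along [v] relative to a maximal
    subspace that contains [M] and avoids [v]. *)
Lemma separating_functional M : subspace M -> forall v, ~ M v ->
  exists2 h : {linear V -> k^o}, h v = 1 & forall x, M x -> h x = 0.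
Proof.
move=> sM v Mv; have [N [[N0 Nlin] MN Nv Nco]] := maximal_subspace sM Mv.
have [c cP] := choice Nco.
have cE x a : N (x - a *: v) -> c x = a.
  move=> Na; apply/eqP; rewrite -subr_eq0; apply/eqP; apply: contrapT => /eqP ca.
  apply: Nv; have -> : v = (c x - a)^-1 *: (- 1 *: (x - c x *: v) + (x - a *: v)) + 0.
    rewrite addr0 scaleN1r opprB addrA subrK -scalerBl.
    by rewrite scalerA mulVf // scale1r.
  by apply: (Nlin) => //; apply: Nlin.
have clin : linear (c : V -> k^o).
  move=> a x y; apply: cE.
  by rewrite scalerDl opprD addrACA -scalerA -scalerBr; apply: Nlin.
pose h : {linear V -> k^o} := HB.pack (c : V -> k^o) (GRing.isLinear.Build _ _ _ _ _ clin).
exists h => [|x Mx]; apply: cE; first by rewrite scale1r subrr.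
by rewrite scale0r subr0; apply: MN.
Qed.
End Separation.

(** * Tensors of minimal length *)

Section TensorSwap.
Variables (k : fieldType) (U V : lmodType k).

Definition tpure_swap (u : U) (v : V) : V ⊗ U := v ⊗ u.

Lemma tpure_swap_bilinear : bilinear_for *:%R *:%R tpure_swap.
Proof.
by split=> [v a u u'|u a v v']; rewrite /tpure_swap /= ?linearPr ?linearPl.
Qed.

HB.instance Definition _ := bilinear_isBilinear.Build k U V (V ⊗ U)%type
  *:%R *:%R tpure_swap tpure_swap_bilinear.

Definition tensor_swap : U ⊗ V -> V ⊗ U := tensor_lift tpure_swap.
HB.instance Definition _ := GRing.Linear.on tensor_swap.

Lemma tensor_swapE u v : tensor_swap (u ⊗ v) = v ⊗ u.
Proof. exact: tensor_liftE. Qed.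

End TensorSwap.

Section TensorSwapTheory.
Variables (k : fieldType) (U U' V V' : lmodType k).

Lemma tensor_swapK (t : U ⊗ V) : tensor_swap (tensor_swap t) = t.
Proof.
apply: (tensor_ext (h := (@tensor_swap k V U \o @tensor_swap k U V)%FUN)
  (h' := idfun)) => u v /=.
by rewrite !tensor_swapE.
Qed.

Lemma tensor_swap_map (f : {linear U -> U'}) (g : {linear V -> V'}) t :
  tensor_swap ((f \⊗ g) t) = (g \⊗ f) (tensor_swap t).
Proof.
apply: (tensor_ext (h := (@tensor_swap k U' V' \o (f \⊗ g))%FUN)
  (h' := ((g \⊗ f) \o @tensor_swap k U V)%FUN)) => u v /=.
by rewrite !(tensor_mapE, tensor_swapE).
Qed.

End TensorSwapTheory.

Section RankDecomposition.
Variable k : fieldType.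

Definition tensor_sum (U V : lmodType k) n (a : 'I_n -> U) (b : 'I_n -> V) : U ⊗ V :=
  \sum_(i < n) a i ⊗ b i.

Lemma tensor_sum_swap (U V : lmodType k) n (a : 'I_n -> U) (b : 'I_n -> V) :
  tensor_swap (tensor_sum a b) = tensor_sum b a.
Proof.
by rewrite /tensor_sum linear_sum; apply: eq_bigr => i _; apply: tensor_swapE.
Qed.

Definition is_tensor_rank (U V : lmodType k) (t : U ⊗ V) n :=
  (exists a b, t = @tensor_sum U V n a b) /\
  forall m a b, t = @tensor_sum U V m a b -> (n <= m)%N.

Lemma ex_tensor_rank (U V : lmodType k) (t : U ⊗ V) : exists n, is_tensor_rank t n.
Proof.
pose P n := `[< exists a b, t = @tensor_sum U V n a b >].
have exP : exists n, P n.
  exists (size (repr t)); apply/asboolP.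
  exists (fun i => (tnth (in_tuple (repr t)) i).1), (fun i => (tnth (in_tuple (repr t)) i).2).
  by rewrite -{1}[t]tensor_classK tensor_class_sum big_tnth.
case: (ex_minnP exP) => n /asboolP nP nmin.
by exists n; split=> // m a b tE; apply: nmin; apply/asboolP; exists a, b.
Qed.

Lemma tensor_rank_swap (U V : lmodType k) (t : U ⊗ V) n :
  is_tensor_rank t n -> is_tensor_rank (tensor_swap t) n.
Proof.
move=> [[a [b ->]] nmin]; split; first by exists b, a; rewrite tensor_sum_swap.
move=> m a' b' E; apply: (nmin m b' a').
by rewrite -[LHS]tensor_swapK E tensor_sum_swap.
Qed.

(** Linear independence, in the form in which it is used: there are dual
    functionals on the whole space. *)
Definition independent (V : lmodType k) n (b : 'I_n -> V) :=
  forall j, exists h : {linear V -> k^o}, forall i, h (b i) = (i == j)%:R.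

(** In a shortest expression of a tensor no [b j] is a combination of the others:
    otherwise its term could be distributed over them, giving a shorter
    expression. A functional separating [b j] from their span is then dual to it. *)
Lemma tensor_rank_independent (U V : lmodType k) n (a : 'I_n -> U) (b : 'I_n -> V) :
  is_tensor_rank (tensor_sum a b) n -> independent b.
Proof.
case: n a b => [|n] a b [_ nmin] j; first by case: j.
pose M v := exists c : 'I_n -> k, v = \sum_i c i *: b (lift j i).
have sM : subspace M.
  split=> [|x v w [c ->] [d ->]].
    by exists (fun=> 0); rewrite big1 // => i _; rewrite scale0r.
  exists (fun i => x * c i + d i); rewrite scaler_sumr -big_split /=.
  by apply: eq_bigr => i _; rewrite scalerDl scalerA.
have Mb i : M (b (lift j i)).
  exists (fun i' => (i' == i)%:R); rewrite (bigD1 i) //= eqxx scale1r big1 ?addr0 //.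
  by move=> i' /negPf ->; rewrite scale0r.
have [[c bE]|Mj] := pselect (M (b j)).
  have /nmin : tensor_sum a b =
      tensor_sum (fun i => a (lift j i) + c i *: a j) (fun i => b (lift j i)).
    rewrite /tensor_sum (bigD1_ord j) //= bE linear_sumr -big_split /=.
    by apply: eq_bigr => i _; rewrite linearDl /= addrC linearZl_LR linearZr_LR.
  by rewrite ltnn.
have [h hj hM] := separating_functional sM Mj.
exists h => i; case: (unliftP j i) => [i' ->|->]; last by rewrite eqxx.
by rewrite hM ?(negPf (neq_lift _ _)) // eq_sym (negPf (neq_lift _ _)).
Qed.

Lemma tensor_decomp (U V : lmodType k) (t : U ⊗ V) :
  exists n (a : 'I_n -> U) (b : 'I_n -> V),
    [/\ t = tensor_sum a b, independent a & independent b].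
Proof.
have [n tn] := ex_tensor_rank t; have [[a [b tE]] _] := tn.
exists n, a, b; split=> //; last by apply: (tensor_rank_independent (a := a)); rewrite -tE.
apply: (tensor_rank_independent (a := b)).
by rewrite -tensor_sum_swap -tE; apply: tensor_rank_swap.
Qed.

(** Contracting the second factor with the functional dual to [b j] recovers the
    value at [a j] of any map applied to the first factor. *)
Lemma tensor_sum_coefl (U V W : lmodType k) n (a : 'I_n -> U) (b : 'I_n -> V)
    (f g : {linear U -> W}) : independent b ->
  (f \⊗ @idfun V) (tensor_sum a b) = (g \⊗ @idfun V) (tensor_sum a b) ->
  forall j, f (a j) = g (a j).
Proof.
move=> dual fg j; have [h hE] := dual j.
have coef (l : {linear U -> W}) :
    tensor_unitr ((@idfun W \⊗ h) ((l \⊗ @idfun V) (tensor_sum a b))) = l (a j).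
  have pureE i : tensor_unitr ((@idfun W \⊗ h) ((l \⊗ @idfun V) (a i ⊗ b i))) =
      (i == j)%:R *: l (a i).
    by rewrite !tensor_mapE tensor_unitrE hE.
  rewrite /tensor_sum (linear_sum (l \⊗ _)) (linear_sum (_ \⊗ h)).
  rewrite (linear_sum (@tensor_unitr k W)) (eq_bigr _ (fun i _ => pureE i)).
  rewrite (bigD1 j) //= eqxx scale1r big1 ?addr0 // => i /negPf ->.
  by rewrite scale0r.
by rewrite -(coef f) fg coef.
Qed.

Lemma tensor_sum_coefr (U V W : lmodType k) n (a : 'I_n -> U) (b : 'I_n -> V)
    (f g : {linear V -> W}) : independent a ->
  (@idfun U \⊗ f) (tensor_sum a b) = (@idfun U \⊗ g) (tensor_sum a b) ->
  forall j, f (b j) = g (b j).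
Proof.
move=> dual fg; apply: (tensor_sum_coefl dual).
by rewrite -tensor_sum_swap -!tensor_swap_map fg.
Qed.

(** Every structure put on a subspace below is transported through this
    injectivity: an identity between tensors on the subspace can be checked in
    the ambient space. *)
Lemma tensor_map_inj (U U' V V' : lmodType k)
    (f : {linear U -> U'}) (g : {linear V -> V'}) :
  injective f -> injective g -> injective (f \⊗ g).
Proof.
have injl (X Y Z : lmodType k) (h : {linear X -> Y}) (t : X ⊗ Z) :
    injective h -> (h \⊗ @idfun Z) t = 0 -> t = 0.
  move=> hI; have [n [a [b [-> _ ib]]]] := tensor_decomp t => h0.
  have /(tensor_sum_coefl ib) ha :
      (h \⊗ @idfun Z) (tensor_sum a b) = ((\0 : X -> Y) \⊗ @idfun Z) (tensor_sum a b).
    rewrite h0; symmetry.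
    apply: (tensor_ext (h := (\0 \⊗ @idfun Z)%FUN) (h' := \0)) => x z /=.
    by rewrite tensor_mapE linear0l.
  rewrite /tensor_sum big1 // => i _.
  by rewrite (_ : a i = 0) ?linear0l //; apply: hI; rewrite ha linear0.
move=> fI gI; apply: raddf_inj => t t0; apply: (injl _ _ _ f _ fI).
rewrite -[LHS]tensor_swapK [X in tensor_swap X](_ : _ = 0) ?linear0 //.
apply: (injl _ _ _ g _ gI); rewrite -tensor_swap_map -[RHS](linear0 (@tensor_swap k U' V')).
congr tensor_swap; rewrite -[RHS]t0.
by rewrite -[LHS](tensor_map_comp idfun f g idfun).
Qed.

End RankDecomposition.

(** * Tensor products of maps and of algebras *)

Section TensorMapTheory.
Variable k : fieldType.

Lemma eq_tensor_map (U U' V V' : lmodType k) (f f' : {linear U -> U'})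
    (g g' : {linear V -> V'}) : f =1 f' -> g =1 g' -> f \⊗ g =1 f' \⊗ g'.
Proof.
by move=> ff' gg'; apply: tensor_ext => u v /=; rewrite !tensor_mapE ff' gg'.
Qed.

Lemma tensor_mapM (U U' U'' V V' V'' : lmodType k)
    (f' : {linear U' -> U''}) (f : {linear U -> U'})
    (g' : {linear V' -> V''}) (g : {linear V -> V'}) t :
  (f' \⊗ g') ((f \⊗ g) t) = ((f' \o f) \⊗ (g' \o g)) t.
Proof. by rewrite tensor_map_comp. Qed.

Lemma tensor_ext3 (U V W X : lmodType k) (h h' : {linear ((U ⊗ V) ⊗ W)%type -> X}) :
  (forall u v w, h ((u ⊗ v) ⊗ w) = h' ((u ⊗ v) ⊗ w)) -> h =1 h'.
Proof.
move=> hh'; apply: tensor_ext => t w.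
elim/tensor_ind: t => [|u v t IHt]; first by rewrite linear0l !linear0.
by rewrite linearDl !linearD /= hh' IHt.
Qed.

Lemma tensor_assoc_map (U U' V V' W W' : lmodType k) (f : {linear U -> U'})
    (g : {linear V -> V'}) (h : {linear W -> W'}) t :
  tensor_assoc (((f \⊗ g) \⊗ h) t) = (f \⊗ (g \⊗ h)) (tensor_assoc t).
Proof.
apply: (tensor_ext3 (h := (@tensor_assoc k _ _ _ \o ((f \⊗ g) \⊗ h))%FUN)
  (h' := ((f \⊗ (g \⊗ h)) \o @tensor_assoc k _ _ _)%FUN)) => u v w.
by rewrite /= tensor_assocE !tensor_mapE /= !tensor_mapE tensor_assocE.
Qed.

End TensorMapTheory.

Section TensorAlgType.
Variables (k : fieldType) (A B : algType k).

Lemma tensor_mulE (a c : A) (b d : B) :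
  (a ⊗ b : tensor A B) * (c ⊗ d) = (a * c) ⊗ (b * d).
Proof. exact: tmulE. Qed.

Lemma tensor_oneE : (1 : tensor A B) = 1 ⊗ 1. Proof. by []. Qed.

(** A product of functionals normalised at the units takes the value 1 at the
    unit of the tensor product. *)
Lemma tensor_oner_neq0 : (1 : tensor A B) != 0.
Proof.
have s0 (V : lmodType k) : subspace (fun v : V => v = 0).
  by split=> // a x y -> ->; rewrite scaler0 addr0.
have n1 (C : algType k) : (1 : C) <> 0 by apply/eqP/oner_neq0.
have [f f1 _] := separating_functional (s0 A) (@n1 A).
have [g g1 _] := separating_functional (s0 B) (@n1 B).
apply/eqP => e0; have := congr1 (@tensor_unitl k k^o \o (f \⊗ g)) e0.
rewrite [RHS]/= [X in tensor_unitl X]linear0 linear0.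
rewrite /comp tensor_oneE tensor_mapE tensor_unitlE f1 g1.
by move/eqP; rewrite scale1r oner_eq0.
Qed.

HB.instance Definition _ :=
  GRing.PzSemiRing_isNonZero.Build (tensor A B) tensor_oner_neq0.

Lemma tensor_scalerAl (a : k) (x y : tensor A B) : a *: (x * y) = a *: x * y.
Proof.
elim/tensor_ind: x => [|u v x IHx]; first by rewrite mul0r scaler0 mul0r.
rewrite scalerDr !mulrDl scalerDr IHx; congr (_ + _); clear.
elim/tensor_ind: y => [|c d y IHy]; first by rewrite !mulr0 scaler0.
rewrite !mulrDr scalerDr IHy; congr (_ + _).
by rewrite -linearZl_LR !tensor_mulE -linearZl_LR scalerAl.
Qed.

HB.instance Definition _ :=
  GRing.Lmodule_isLalgebra.Build k (tensor A B) tensor_scalerAl.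

Lemma tensor_scalerAr (a : k) (x y : tensor A B) : a *: (x * y) = x * (a *: y).
Proof.
elim/tensor_ind: x => [|u v x IHx]; first by rewrite !mul0r scaler0.
rewrite !mulrDl scalerDr IHx; congr (_ + _); clear.
elim/tensor_ind: y => [|c d y IHy]; first by rewrite scaler0 !mulr0 scaler0.
rewrite !scalerDr !mulrDr scalerDr IHy; congr (_ + _).
by rewrite -linearZr_LR !tensor_mulE -linearZr_LR scalerAr.
Qed.

HB.instance Definition _ :=
  GRing.Lalgebra_isAlgebra.Build k (tensor A B) tensor_scalerAr.

End TensorAlgType.

Section MonoidMorphisms.
Variable k : fieldType.

Lemma tensor_map_monoid_morphism (A A' B B' : algType k)
    (f : {linear A -> A'}) (g : {linear B -> B'}) :
  monoid_morphism f -> monoid_morphism g ->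
  monoid_morphism (f \⊗ g : tensor A B -> tensor A' B').
Proof.
move=> [f1 fM] [g1 gM]; split; first by rewrite tensor_oneE tensor_mapE f1 g1.
move=> x y; elim/tensor_ind: x => [|a b x IHx]; first by rewrite mul0r !linear0 mul0r.
rewrite mulrDl !linearD /= mulrDl IHx; congr (_ + _); clear x IHx.
elim/tensor_ind: y => [|c d y IHy]; first by rewrite mulr0 !linear0 mulr0.
rewrite mulrDr !linearD /= mulrDr IHy; congr (_ + _).
by rewrite tensor_mulE !tensor_mapE fM gM -tensor_mulE.
Qed.

Lemma comp_monoid_morphism (A B C : pzSemiRingType) (f : B -> C) (g : A -> B) :
  monoid_morphism f -> monoid_morphism g -> monoid_morphism (f \o g).
Proof. by move=> [f1 fM] [g1 gM]; split=> [|x y] /=; rewrite ?g1 ?f1 ?gM ?fM. Qed.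

Lemma tensor_mult_morph (A B : algType k) (f : {linear A -> B}) t :
  monoid_morphism f -> tensor_mult ((f \⊗ f) t) = f (tensor_mult t).
Proof.
move=> [_ fM].
apply: (tensor_ext (h := (@tensor_mult k B \o (f \⊗ f))%FUN)
  (h' := (f \o @tensor_mult k A)%FUN)) => x y.
by rewrite /= tensor_mapE !tensor_multE fM.
Qed.

End MonoidMorphisms.

(** * Convolution and antipodes *)

Section Convolution.
Variables (k : fieldType) (C : coalgType k) (A : algType k).
Implicit Types L M R : {linear C -> A}.

Definition convolution L M : C -> A := @tensor_mult k A \o (L \⊗ M) \o comul.
HB.instance Definition _ L M := GRing.Linear.on (convolution L M).

Definition conv_unit (x : C) : A := (counit x : k) *: 1.

Lemma conv_unit_linear : linear conv_unit.
Proof. by move=> a x y; rewrite /conv_unit linearP scalerDl scalerA. Qed.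
HB.instance Definition _ := GRing.isLinear.Build k C A *:%R conv_unit conv_unit_linear.

Lemma conv_unitl L x : convolution conv_unit L x = L x.
Proof.
rewrite -{2}[x]counitl /convolution /=.
apply: (tensor_ext (h := (@tensor_mult k A \o (conv_unit \⊗ L))%FUN)
  (h' := (L \o @tensor_unitl k C \o (counit \⊗ @idfun C))%FUN)) => u v.
rewrite /= !tensor_mapE tensor_multE tensor_unitlE /conv_unit /=.
by rewrite linearZ -scalerAl mul1r.
Qed.

Lemma conv_unitr L x : convolution L conv_unit x = L x.
Proof.
rewrite -{2}[x]counitr /convolution /=.
apply: (tensor_ext (h := (@tensor_mult k A \o (L \⊗ conv_unit))%FUN)
  (h' := (L \o @tensor_unitr k C \o (@idfun C \⊗ counit))%FUN)) => u v.
rewrite /= !tensor_mapE tensor_multE tensor_unitrE /conv_unit /=.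
by rewrite linearZ -scalerAr mulr1.
Qed.

Lemma eq_convolution L L' M M' :
  L =1 L' -> M =1 M' -> convolution L M =1 convolution L' M'.
Proof. by move=> LL' MM' x; rewrite /convolution /= (eq_tensor_map LL' MM'). Qed.

Lemma convolutionA L M R x :
  convolution (convolution L M) R x = convolution L (convolution M R) x.
Proof.
transitivity (tensor_mult (((@tensor_mult k A \o (L \⊗ M)) \⊗ R)
    ((comul \⊗ @idfun C) (comul x)))).
  by rewrite tensor_mapM.
transitivity (tensor_mult ((L \⊗ (@tensor_mult k A \o (M \⊗ R)))
    ((@idfun C \⊗ comul) (comul x)))); last by rewrite tensor_mapM.
rewrite -comulA; move: ((comul \⊗ idfun) (comul x)) => t.
apply: (tensor_ext3 (h := (@tensor_mult k A \o ((@tensor_mult k A \o (L \⊗ M)) \⊗ R))%FUN)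
  (h' := (@tensor_mult k A \o (L \⊗ (@tensor_mult k A \o (M \⊗ R))) \o
    @tensor_assoc k C C C)%FUN)) => u v w.
by rewrite /= tensor_assocE !tensor_mapE /= !tensor_mapE !tensor_multE mulrA.
Qed.

(** The usual argument in a monoid: L = L * (M * R) = (L * M) * R = R. *)
Lemma conv_inverse_uniq L M R :
  convolution L M =1 conv_unit -> convolution M R =1 conv_unit -> L =1 R.
Proof.
move=> LM MR x; rewrite -conv_unitr -(eq_convolution (frefl L) MR) -convolutionA.
by rewrite (eq_convolution LM (frefl R)) conv_unitl.
Qed.

End Convolution.

Section AntipodeConvolution.
Variables (k : fieldType) (C : coalgType k) (H : hopfAlgType k) (A : algType k).
Variable i : {linear C -> H}.
Hypotheses (iD : forall x, comul (i x) = (i \⊗ i) (comul x))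
           (iE : forall x, counit (i x) = counit x).

Lemma algebra_map_unit (F : {linear H -> A}) x : monoid_morphism F ->
  F ((counit (i x) : k) *: 1) = conv_unit A x.
Proof. by move=> [F1 _]; rewrite linearZ /= [F 1]F1 iE. Qed.

Lemma conv_antipodel (F : {linear H -> A}) : monoid_morphism F ->
  convolution (F \o @antipode k H \o i) (F \o i) =1 conv_unit A.
Proof.
move=> FM x; rewrite -(algebra_map_unit x FM) -antipodel -tensor_mult_morph //.
by rewrite iD !tensor_mapM.
Qed.

Lemma conv_antipoder (F : {linear H -> A}) : monoid_morphism F ->
  convolution (F \o i) (F \o @antipode k H \o i) =1 conv_unit A.
Proof.
move=> FM x; rewrite -(algebra_map_unit x FM) -antipoder -tensor_mult_morph //.
by rewrite iD !tensor_mapM.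
Qed.

(** If [F] and [G] are algebra maps that agree on the subcoalgebra [C], then [F ∘ S]
    and [G ∘ S], restricted to [C], are both convolution inverses of the common
    restriction, hence equal. *)
Lemma algebra_maps_eq_antipode (F G : {linear H -> A}) :
  monoid_morphism F -> monoid_morphism G ->
  (forall x, F (i x) = G (i x)) ->
  forall x, F (antipode (i x)) = G (antipode (i x)).
Proof.
move=> FM GM FG; apply: (@conv_inverse_uniq _ _ _ (F \o @antipode k H \o i)
  (F \o i) (G \o @antipode k H \o i) (conv_antipodel FM)) => x.
by rewrite (eq_convolution (L := F \o i) (L' := G \o i) FG (frefl _)) conv_antipoder.
Qed.

End AntipodeConvolution.

(** * The map x ↦ x_(1) ⊗ f(x_(2)) ⊗ x_(3) *)

Section TensorAssocV.
Variable k : fieldType.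

(** The inverse of the associator, obtained from the associator itself by
    reversing the order of the three factors before and after. *)
Definition tensor_assocV (U V W : lmodType k) : U ⊗ (V ⊗ W) -> (U ⊗ V) ⊗ W :=
  (@tensor_swap k V U \⊗ @idfun W) \o @tensor_swap k W (V ⊗ U)%type \o
  @tensor_assoc k W V U \o (@tensor_swap k V W \⊗ @idfun U) \o
  @tensor_swap k U (V ⊗ W)%type.
HB.instance Definition _ (U V W : lmodType k) :=
  GRing.Linear.on (@tensor_assocV U V W).

Lemma tensor_assocVE (U V W : lmodType k) (u : U) (v : V) (w : W) :
  tensor_assocV (u ⊗ (v ⊗ w)) = (u ⊗ v) ⊗ w.
Proof.
have swap_id (X Y Z : lmodType k) (x : X) (y : Y) (z : Z) :
    (@tensor_swap k X Y \⊗ @idfun Z) ((x ⊗ y) ⊗ z) = (y ⊗ x) ⊗ z.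
  by rewrite tensor_mapE /= tensor_swapE.
transitivity ((@tensor_swap k V U \⊗ @idfun W) (tensor_swap (tensor_assoc
  ((@tensor_swap k V W \⊗ @idfun U) (tensor_swap (u ⊗ (v ⊗ w))))))); first by [].
by rewrite tensor_swapE swap_id tensor_assocE tensor_swapE swap_id.
Qed.

Lemma tensor_assocK (U V W : lmodType k) (t : (U ⊗ V) ⊗ W) :
  tensor_assocV (tensor_assoc t) = t.
Proof.
apply: (tensor_ext3 (h := (@tensor_assocV U V W \o @tensor_assoc k U V W)%FUN)
  (h' := idfun)) => u v w /=.
by rewrite tensor_assocE tensor_assocVE.
Qed.

Lemma tensor_assocVK (U V W : lmodType k) (t : U ⊗ (V ⊗ W)) :
  tensor_assoc (tensor_assocV t) = t.
Proof.
elim/tensor_ind: t => [|u s t IHt]; first by rewrite !linear0.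
rewrite !linearD /= IHt; congr (_ + _).
elim/tensor_ind: s => [|v w s IHs]; first by rewrite linear0r !linear0.
by rewrite linearDr !linearD /= IHs tensor_assocVE tensor_assocE.
Qed.

Lemma tensor_assocV_map (U U' V V' W W' : lmodType k) (f : {linear U -> U'})
    (g : {linear V -> V'}) (h : {linear W -> W'}) t :
  tensor_assocV ((f \⊗ (g \⊗ h)) t) = ((f \⊗ g) \⊗ h) (tensor_assocV t).
Proof. by rewrite -{1}[t]tensor_assocVK -tensor_assoc_map tensor_assocK. Qed.

End TensorAssocV.

Section Sandwich.
Variables (k : fieldType) (A : coalgType k) (B : lmodType k).
Implicit Types (f g : {linear A -> B}).

(** The two sides of the equation defining the equalizer are [sandwich f x] and
    [sandwich g x]. *)
Definition sandwich f : A -> A ⊗ (B ⊗ A) :=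
  (@idfun A \⊗ (f \⊗ @idfun A)) \o (@idfun A \⊗ @comul k A) \o @comul k A.
HB.instance Definition _ f := GRing.Linear.on (sandwich f).

Lemma sandwichE f x :
  sandwich f x = (@idfun A \⊗ ((f \⊗ @idfun A) \o @comul k A)) (comul x).
Proof. by rewrite /sandwich /= tensor_mapM. Qed.

Lemma comulAV (x : A) :
  (@comul k A \⊗ @idfun A) (comul x) = tensor_assocV ((@idfun A \⊗ @comul k A) (comul x)).
Proof. by rewrite -comulA tensor_assocK. Qed.

(** By coassociativity both sides are x_(1) ⊗ f(x_(2)) ⊗ x_(3) ⊗ x_(4). The point is
    that the right-hand side is a function of [sandwich f x] that does not
    involve [f]: it applies Δ to the last factor. Its mirror image below applies
    Δ to the first factor. *)
Lemma sandwich_comull f x :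
  (sandwich f \⊗ @idfun A) (comul x) =
  tensor_assocV ((@idfun A \⊗ (@tensor_assocV k B A A \o (@idfun B \⊗ @comul k A)))
    (sandwich f x)).
Proof.
transitivity (((@idfun A \⊗ ((f \⊗ @idfun A) \o @comul k A)) \⊗ @idfun A)
    ((@comul k A \⊗ @idfun A) (comul x))).
  by rewrite tensor_mapM; apply: eq_tensor_map => // y; apply: sandwichE.
rewrite comulAV -tensor_assocV_map tensor_mapM sandwichE tensor_mapM.
congr tensor_assocV; apply: eq_tensor_map => // y /=.
transitivity (((f \⊗ @idfun A) \⊗ @idfun A) ((@comul k A \⊗ @idfun A) (comul y))).
  by rewrite tensor_mapM.
rewrite comulAV -tensor_assocV_map !tensor_mapM.
by congr tensor_assocV; apply: eq_tensor_map => // z /=; rewrite tensor_map_id.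
Qed.

Lemma sandwich_comulr f x :
  (@idfun A \⊗ sandwich f) (comul x) =
  tensor_assoc ((@comul k A \⊗ @idfun (B ⊗ A)%type) (sandwich f x)).
Proof.
transitivity ((@idfun A \⊗ (@idfun A \⊗ ((f \⊗ @idfun A) \o @comul k A)))
    ((@idfun A \⊗ @comul k A) (comul x))).
  by rewrite tensor_mapM; apply: eq_tensor_map => // y; apply: sandwichE.
rewrite -comulA -tensor_assoc_map sandwichE !tensor_mapM.
by congr tensor_assoc; apply: eq_tensor_map => // y /=; rewrite tensor_map_id.
Qed.

(** Applying [sandwich f] or [sandwich g] to one of the two factors of Δ(x) gives the
    same result, because that result is determined by the common value at [x]; in
    an expression of Δ(x) with independent components on both sides, every
    component therefore lies in the equalizer, which is thus a subcoalgebra. *)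
Lemma comul_sandwich_eq f g x : sandwich f x = sandwich g x ->
  exists n (a b : 'I_n -> A), [/\ comul x = tensor_sum a b,
    forall i, sandwich f (a i) = sandwich g (a i) & forall i, sandwich f (b i) = sandwich g (b i)].
Proof.
move=> fg; have [n [a [b [E ia ib]]]] := tensor_decomp (comul x).
exists n, a, b; split=> //.
  by apply: (tensor_sum_coefl ib); rewrite -E !sandwich_comull fg.
by apply: (tensor_sum_coefr ia); rewrite -E !sandwich_comulr fg.
Qed.

Lemma counit_contractr f x :
  tensor_unitr ((f \⊗ @counit k A) (comul x)) = f x.
Proof.
rewrite -[in RHS](counitr x); move: (comul x) => t.
apply: (tensor_ext (h := (@tensor_unitr k B \o (f \⊗ counit))%FUN)
  (h' := (f \o @tensor_unitr k A \o (@idfun A \⊗ counit))%FUN)) => u v.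
by rewrite /= !tensor_mapE !tensor_unitrE linearZ.
Qed.

(** The counit on the outer factors turns x_(1) ⊗ f(x_(2)) ⊗ x_(3) into f(x). *)
Lemma sandwich_counit f x : tensor_unitl ((counit \⊗
  (@tensor_unitr k B \o (@idfun B \⊗ @counit k A))) (sandwich f x)) = f x.
Proof.
rewrite sandwichE tensor_mapM -[in RHS](counitl x).
transitivity (tensor_unitl ((@counit k A \⊗ f) (comul x))).
  congr tensor_unitl; apply: eq_tensor_map => // y.
  by rewrite /= tensor_mapM /= -[RHS]counit_contractr.
move: (comul x) => t.
apply: (tensor_ext (h := (@tensor_unitl k B \o (counit \⊗ f))%FUN)
  (h' := (f \o @tensor_unitl k A \o (counit \⊗ @idfun A))%FUN)) => u v.
by rewrite /= !tensor_mapE !tensor_unitlE linearZ.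
Qed.

End Sandwich.

(** * The Hopf subalgebra on which f and g have the same sandwich *)

Section HopfEqualizer.
Variables (k : fieldType) (A B : hopfAlgType k) (f g : {hopf A -> B}).

Lemma hopf_eq_setP x : reflect (sandwich f x = sandwich g x) (x \in hopf_eq_set f g).
Proof. exact: asboolP. Qed.

Lemma sandwich_monoid_morphism (h : {hopf A -> B}) :
  monoid_morphism (sandwich h : A -> tensor A (tensor B A)).
Proof.
have id1 (C : algType k) : monoid_morphism (@idfun C) by [].
have h1 : monoid_morphism h by split; [exact: rmorph1 | exact: rmorphM].
apply: comp_monoid_morphism; last exact: comul_monoid_morphism.
apply: comp_monoid_morphism.
  exact/tensor_map_monoid_morphism/tensor_map_monoid_morphism.
exact/tensor_map_monoid_morphism/comul_monoid_morphism.
Qed.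

Lemma hopf_eq_subalg_closed : subalg_closed (hopf_eq_set f g).
Proof.
have [f1 fM] := sandwich_monoid_morphism f; have [g1 gM] := sandwich_monoid_morphism g.
split=> [|a x y|x y].
- by apply/hopf_eq_setP; rewrite [LHS]f1 [RHS]g1.
- move=> /hopf_eq_setP xE /hopf_eq_setP yE; apply/hopf_eq_setP.
  by rewrite !linearP /= xE yE.
- move=> /hopf_eq_setP xE /hopf_eq_setP yE; apply/hopf_eq_setP.
  by rewrite [LHS]fM [RHS]gM xE yE.
Qed.

HB.instance Definition _ :=
  GRing.isSubalgClosed.Build k A (hopf_eq_set f g) hopf_eq_subalg_closed.

Definition hopf_eq := {x : A | hopf_eq_set f g x}.
HB.instance Definition _ := [isSub of hopf_eq for @sval A (hopf_eq_set f g)].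
HB.instance Definition _ := [Choice of hopf_eq by <:].
HB.instance Definition _ := [SubChoice_isSubAlgebra of hopf_eq by <:].

Notation incl := (val : hopf_eq -> A).

Lemma hopf_eqP (x : hopf_eq) : sandwich f (val x) = sandwich g (val x).
Proof. exact/hopf_eq_setP/(valP x). Qed.

Lemma hopf_eq_comul_ex (x : hopf_eq) :
  exists t : hopf_eq ⊗ hopf_eq, (incl \⊗ incl) t = comul (val x).
Proof.
have [n [a [b [-> fa fb]]]] := comul_sandwich_eq (hopf_eqP x).
have aS i : hopf_eq_set f g (a i) by apply/hopf_eq_setP.
have bS i : hopf_eq_set f g (b i) by apply/hopf_eq_setP.
exists (tensor_sum (fun i => Sub (a i) (aS i) : hopf_eq) (fun i => Sub (b i) (bS i) : hopf_eq)).
rewrite /tensor_sum (linear_sum (incl \⊗ incl)).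
by apply: eq_bigr => i _; rewrite [LHS]tensor_mapE.
Qed.

(** The comultiplication of the subspace is the corestriction of that of [A]; the
    tensor is unique by injectivity of the tensor square of the inclusion. *)
Definition hopf_eq_comul x := projT1 (cid (hopf_eq_comul_ex x)).

Lemma hopf_eq_comulE x : (incl \⊗ incl) (hopf_eq_comul x) = comul (val x).
Proof. exact: projT2 (cid (hopf_eq_comul_ex x)). Qed.

Lemma incl2_inj : injective (incl \⊗ incl).
Proof. by apply: tensor_map_inj; apply: val_inj. Qed.

Lemma hopf_eq_comul_linear : linear hopf_eq_comul.
Proof.
move=> a x y; apply: incl2_inj.
by rewrite [RHS](linearP (incl \⊗ incl)) /= !hopf_eq_comulE !linearP.
Qed.
HB.instance Definition _ := GRing.isLinear.Build k hopf_eq (hopf_eq ⊗ hopf_eq)%type *:%R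
  hopf_eq_comul hopf_eq_comul_linear.

Definition hopf_eq_counit : hopf_eq -> k^o := @counit k A \o incl.
HB.instance Definition _ := GRing.Linear.on hopf_eq_counit.

Lemma hopf_eq_comulA x :
  tensor_assoc ((hopf_eq_comul \⊗ idfun) (hopf_eq_comul x)) =
  (idfun \⊗ hopf_eq_comul) (hopf_eq_comul x).
Proof.
apply: (tensor_map_inj (f := incl) (g := incl \⊗ incl) val_inj incl2_inj).
rewrite -tensor_assoc_map !tensor_mapM.
transitivity (tensor_assoc ((@comul k A \⊗ @idfun A) (comul (val x)))).
  rewrite -hopf_eq_comulE tensor_mapM; congr tensor_assoc.
  by apply: eq_tensor_map => // y; apply: hopf_eq_comulE.
rewrite comulA -hopf_eq_comulE tensor_mapM.
by apply: eq_tensor_map => // y; rewrite /= hopf_eq_comulE.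
Qed.

Lemma hopf_eq_counitl x :
  tensor_unitl ((hopf_eq_counit \⊗ idfun) (hopf_eq_comul x)) = x.
Proof.
apply: val_inj; rewrite -[RHS]counitl -hopf_eq_comulE tensor_mapM.
move: (hopf_eq_comul x) => t.
apply: (tensor_ext (h := (incl \o @tensor_unitl k hopf_eq \o (hopf_eq_counit \⊗ idfun))%FUN)
  (h' := (@tensor_unitl k A \o ((@counit k A \o incl) \⊗ (@idfun A \o incl)))%FUN)) => u v.
rewrite /= !tensor_mapE !tensor_unitlE; exact: (linearZZ incl).
Qed.

Lemma hopf_eq_counitr x :
  tensor_unitr ((idfun \⊗ hopf_eq_counit) (hopf_eq_comul x)) = x.
Proof.
apply: val_inj; rewrite -[RHS]counitr -hopf_eq_comulE tensor_mapM.
move: (hopf_eq_comul x) => t.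
apply: (tensor_ext (h := (incl \o @tensor_unitr k hopf_eq \o (idfun \⊗ hopf_eq_counit))%FUN)
  (h' := (@tensor_unitr k A \o ((@idfun A \o incl) \⊗ (@counit k A \o incl)))%FUN)) => u v.
rewrite /= !tensor_mapE !tensor_unitrE; exact: (linearZZ incl).
Qed.

HB.instance Definition _ := Lmodule_isCoalgebra.Build k hopf_eq
  hopf_eq_comulA hopf_eq_counitl hopf_eq_counitr.

Lemma hopf_eq_val_comul (x : hopf_eq) : comul (val x) = (incl \⊗ incl) (comul x).
Proof. by rewrite -hopf_eq_comulE. Qed.

Lemma hopf_eq_comul_monoid :
  monoid_morphism (comul : hopf_eq -> (hopf_eq ⊗ hopf_eq)%type).
Proof.
have v1 : monoid_morphism incl by split; [exact: rmorph1 | exact: rmorphM].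
have [i1 iM] := tensor_map_monoid_morphism v1 v1.
have [c1 cM] := @comul_monoid_morphism k A.
split=> [|x y]; apply: incl2_inj.
  by rewrite -hopf_eq_val_comul rmorph1 [RHS]i1 [LHS]c1.
by rewrite -hopf_eq_val_comul rmorphM [RHS]iM [LHS]cM !hopf_eq_val_comul.
Qed.

Lemma hopf_eq_counit_monoid : monoid_morphism (counit : hopf_eq -> k).
Proof.
have [c1 cM] := @counit_monoid_morphism k A.
by split=> [|x y]; [apply: c1 | apply: cM].
Qed.

HB.instance Definition _ := isBialgebra.Build k hopf_eq
  hopf_eq_comul_monoid hopf_eq_counit_monoid.

(** Both sandwich maps are algebra maps, and they agree on the subcoalgebra. *)
Lemma hopf_eq_antipode_in (x : hopf_eq) : hopf_eq_set f g (antipode (incl x)).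
Proof.
apply/hopf_eq_setP.
exact: (algebra_maps_eq_antipode hopf_eq_val_comul (fun=> erefl)
  (sandwich_monoid_morphism f) (sandwich_monoid_morphism g) hopf_eqP).
Qed.

Definition hopf_eq_antipode (x : hopf_eq) : hopf_eq :=
  Sub (antipode (incl x)) (hopf_eq_antipode_in x).

Lemma hopf_eq_antipode_linear : linear hopf_eq_antipode.
Proof. by move=> a x y; apply: val_inj; rewrite linearP !SubK !linearP. Qed.
HB.instance Definition _ :=
  GRing.isLinear.Build k hopf_eq hopf_eq *:%R hopf_eq_antipode hopf_eq_antipode_linear.

Lemma val_tensor_mult t : tensor_mult ((incl \⊗ incl) t) = incl (tensor_mult t).
Proof. by apply: tensor_mult_morph; split; [exact: rmorph1 | exact: rmorphM]. Qed.

Lemma val_counitZ x : incl ((counit x : k) *: 1) = (counit (incl x) : k) *: 1.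
Proof. by rewrite (linearZZ incl) rmorph1. Qed.

Lemma hopf_eq_antipodel x :
  tensor_mult ((hopf_eq_antipode \⊗ idfun) (comul x)) = (counit x : k) *: 1.
Proof.
apply: val_inj; rewrite -val_tensor_mult val_counitZ -antipodel hopf_eq_val_comul.
by rewrite !tensor_mapM.
Qed.

Lemma hopf_eq_antipoder x :
  tensor_mult ((idfun \⊗ hopf_eq_antipode) (comul x)) = (counit x : k) *: 1.
Proof.
apply: val_inj; rewrite -val_tensor_mult val_counitZ -antipoder hopf_eq_val_comul.
by rewrite !tensor_mapM.
Qed.

HB.instance Definition _ :=
  hasAntipode.Build k hopf_eq hopf_eq_antipodel hopf_eq_antipoder.

HB.instance Definition _ := isSubCoalgebra.Build k A (hopf_eq_set f g) hopf_eq
  hopf_eq_val_comul (fun=> erefl).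

Definition hopf_equalizer : subHopfAlgType (hopf_eq_set f g) := hopf_eq.

End HopfEqualizer.

Lemma hopf_eq_set_eq (k : fieldType) (A B : hopfAlgType k) (f g : {hopf A -> B}) x :
  x \in hopf_eq_set f g -> f x = g x.
Proof.
by move=> /hopf_eq_setP fg; rewrite -(sandwich_counit f) fg sandwich_counit.
Qed.

(** * Universal property *)

Section Corestriction.
Variables (k : fieldType) (A B Y : hopfAlgType k) (f g : {hopf A -> B}).
Variables (D : subHopfAlgType (hopf_eq_set f g)) (h : {hopf Y -> A}).
Hypothesis fgh : forall y, f (h y) = g (h y).

(** As [h] is comultiplicative, the sandwich of [h y] is
    h(y_(1)) ⊗ f(h(y_(2))) ⊗ h(y_(3)). *)
Lemma hopf_eq_factor_in y : hopf_eq_set f g (h y).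
Proof.
apply/hopf_eq_setP; rewrite !sandwichE !comul_morph !tensor_mapM.
apply: eq_tensor_map => // z /=; rewrite comul_morph !tensor_mapM.
exact: eq_tensor_map.
Qed.

Definition hopf_eq_factor y : D := Sub (h y) (hopf_eq_factor_in y).

Lemma hopf_eq_factorE y : val (hopf_eq_factor y) = h y.
Proof. exact: SubK. Qed.

Lemma hopf_eq_factor_linear : linear hopf_eq_factor.
Proof.
move=> a x y; apply: val_inj.
rewrite [RHS](linearP (val : D -> A)) /= !hopf_eq_factorE; exact: linearP.
Qed.
HB.instance Definition _ := GRing.isLinear.Build k Y D *:%R
  hopf_eq_factor hopf_eq_factor_linear.

Lemma hopf_eq_factor_monoid : monoid_morphism hopf_eq_factor.
Proof.
split=> [|x y]; apply: val_inj.
  by rewrite hopf_eq_factorE [RHS](rmorph1 (val : D -> A)) rmorph1.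
rewrite [RHS](rmorphM (val : D -> A)) /= !hopf_eq_factorE; exact: rmorphM.
Qed.
HB.instance Definition _ := GRing.isMonoidMorphism.Build Y D
  hopf_eq_factor hopf_eq_factor_monoid.

Lemma hopf_eq_factor_comul y :
  comul (hopf_eq_factor y) = (hopf_eq_factor \⊗ hopf_eq_factor) (comul y).
Proof.
apply: (tensor_map_inj (f := val : D -> A) (g := val : D -> A) val_inj val_inj).
rewrite -val_comul SubK comul_morph tensor_mapM.
by apply: eq_tensor_map => z /=; rewrite SubK.
Qed.

Lemma hopf_eq_factor_counit y : counit (hopf_eq_factor y) = counit y.
Proof. by rewrite -val_counit SubK counit_morph. Qed.

HB.instance Definition _ := isCoalgMorphism.Build k Y D hopf_eq_factor
  hopf_eq_factor_comul hopf_eq_factor_counit.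

Definition hopf_eq_lift : {hopf Y -> D} := hopf_eq_factor.

End Corestriction.

Theorem mainTheorem6 (k : fieldType) (J : category) (F : functor J (HopfAlg k))
    (P : HopfAlg k) (p : forall j : J, Mor P (F j))
    (Q : HopfAlg k) (q : forall u : arrow J, Mor Q (F (acod u)))
    (Pprod : is_product p) (Qprod : is_product q)
    (f g : Mor P Q)
    (fE : forall u : arrow J, ccomp (q u) f = p (acod u))
    (gE : forall u : arrow J, ccomp (q u) g = ccomp (fmap F u) (p (adom u))) :
  exists D : subHopfAlgType (hopf_eq_set f g),
    let e : Mor (D : HopfAlg k) P := hopf_incl D in
    is_limit (fun j : J => ccomp (p j) e).
Proof.
exists (hopf_equalizer f g) => e.
have feq : ccomp f e = ccomp g e.
  apply: hopf_morphism_ext => x; apply: (@hopf_eq_set_eq k P Q f g (val (x : hopf_eq f g))).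
  exact: (valP (x : hopf_eq f g)).
split=> [i j u|Y psi psiC].
  pose w := Arrow u.
  by rewrite ccompA -(gE w) -ccompA -feq ccompA (fE w).
have [h [hE hU]] := Pprod Y psi.
have fgh : ccomp f h = ccomp g h.
  have [l [_ lU]] := Qprod Y (fun u => psi (acod u)).
  rewrite -(lU (ccomp f h)) => [|u]; last by rewrite ccompA fE hE.
  by apply: lU => u; rewrite ccompA gE -ccompA hE; apply: psiC.
have fgh' y : (f \o h : {hopf Y -> Q}) y = (g \o h : {hopf Y -> Q}) y.
  exact: (congr1 (fun m : {hopf Y -> Q} => m y) fgh).
pose h' := hopf_eq_lift (hopf_equalizer f g) fgh'.
have eh' : ccomp e (h' : Mor Y (hopf_equalizer f g : HopfAlg k)) = h.
  exact: hopf_morphism_ext.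
exists h'; split=> [j|m mE]; first by rewrite -ccompA eh' hE.
have em : ccomp e m = h by symmetry; apply: hU => j; rewrite ccompA mE.
apply: hopf_morphism_ext => y; apply: val_inj.
by rewrite hopf_eq_factorE -em.
Qed.
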